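(* Let $S$ be an ordered semigroup. Then the following conditions are equivalent: (1) $S$ is a semilattice of left $\pi$-$t$-simple ordered semigroups; (2) $S$ is $\pi$-regular and $ab\,\mathcal{L}^*\,ba$ for every $a,b\in S$; (3) $S$ is $\pi$-regular and right weakly commutative; (4) for all $a,b\in S$ there exists $m\in\mathbb{N}$ such that $(ab)^m\in((ab)^mS(ba)^{m+1}]$; (5) $S$ is a semilattice of ordered semigroups each of which is a nil-extension of a left simple and $\pi$-regular ordered semigroup.
   Context: An ordered semigroup $(S,\cdot,\leq)$ is a (nonempty) semigroup with a partial order such that $a\leq b$ implies $xa\leq xb$ and $ax\leq bx$ for all $a,b,x\in S$. $\mathbb{N}$ denotes the positive integers. For $A\subseteq S$, $(A]=\{x\in S: x\leq a \text{ for some } a\in A\}$. A subsemigroup is regarded as an ordered semigroup with the restricted order. A nonempty $A\subseteq S$ is a left ideal if $SA\subseteq A$ and $(A]=A$, a right ideal if $AS\subseteq A$ and $(A]=A$, and an ideal if it is both. $S$ is left simple if it has no proper left ideal (equivalently $S=(Sa]$ for all $a\in S$). $S$ is $\pi$-regular if for every $a\in S$ there is $m\in\mathbb{N}$ with $a^m\in(a^mSa^m]$. $S$ is left $\pi$-$t$-simple if there is a subsemigroup $H$ of $S$ which, as an ordered semigroup, is left simple and $\pi$-regular, such that for every $a\in S$ there is $m\in\mathbb{N}$ with $a^m\in H$. $S$ is a nil-extension of $K$ if $K$ is an ideal of $S$ and for every $a\in S$ there is $m\in\mathbb{N}$ with $a^m\in K$. $S$ is right weakly commutative if for all $a,b\in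 S$ there is $n\in\mathbb{N}$ with $(ab)^n\in(Sa]$. $L(a)=(\{a\}\cup Sa]$, and $a\,\mathcal{L}\,b$ iff $L(a)=L(b)$. $Reg_\leq(S)=\{a\in S: a\in(aSa]\}$. For $S$ $\pi$-regular, $a\,\mathcal{L}^*\,b$ iff $a^m\,\mathcal{L}\,b^n$, where $m,n$ are the smallest positive integers such that $a^m,b^n\in Reg_\leq(S)$. A semilattice congruence on $S$ is a congruence $\rho$ of the semigroup $S$ such that $a\,\rho\,a^2$ and $ab\,\rho\,ba$ for all $a,b\in S$. $S$ is a semilattice of ordered semigroups of type $\tau$ if there is a semilattice congruence $\rho$ on $S$ such that each $\rho$-class is a subsemigroup of $S$ of type $\tau$. *)

(* Defs.v *)
From HB Require Import structures.
From mathcomp Require Import all_boot all_order.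
From mathcomp Require Import boolp classical_sets.

Set Implicit Arguments.
Unset Strict Implicit.
Unset Printing Implicit Defensive.

Local Open Scope classical_set_scope.
Local Open Scope order_scope.
Local Open Scope group_scope.

HB.mixin Record isOrderedSemigroup (d : Order.disp_t) S
    of Semigroup S & Order.POrder d S := {
  osg_nonempty : exists x : S, True ;
  osg_le_mull : forall x a b : S, a <= b -> x * a <= x * b ;
  osg_le_mulr : forall x a b : S, a <= b -> a * x <= b * x
}.

#[short(type="orderedSemigroupType")]
HB.structure Definition OrderedSemigroup (d : Order.disp_t) :=
  { S of isOrderedSemigroup d S & Semigroup S & Order.POrder d S }.

Record subsemigroup (d : Order.disp_t) (S : orderedSemigroupType d) :=
  Subsemigroup {
    ssg_set :> set S ;
    ssg_nonempty : ssg_set !=set0 ;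
    ssg_closed : forall x y, ssg_set x -> ssg_set y -> ssg_set (x * y)
  }.

(* A subsemigroup as an ordered semigroup in its own right, with the restricted
   product and order. *)
Definition ssg_sort (d : Order.disp_t) (S : orderedSemigroupType d)
  (H : subsemigroup S) : Type := set_type H.

Section SubsemigroupStructure.
Context {d : Order.disp_t} {S : orderedSemigroupType d} (H : subsemigroup S).

HB.instance Definition _ := SubChoice.on (ssg_sort H).

Fact ssg_mulg_closed : mulg_closed [pred x : S | x \in (H : set S)].
Proof.
by move=> x y /set_mem Hx /set_mem Hy; apply/mem_set/ssg_closed.
Qed.

HB.instance Definition _ :=
  SubChoice_isSubSemigroup.Build S _ (ssg_sort H) ssg_mulg_closed.
HB.instance Definition _ :=
  [SubChoice_isSubPOrder of ssg_sort H by <: with d].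

Fact ssg_sort_nonempty : exists x : ssg_sort H, True.
Proof. by have [x /mem_set Hx] := ssg_nonempty H; exists (exist _ x Hx). Qed.

Fact ssg_le_mull (x a b : ssg_sort H) : a <= b -> x * a <= x * b.
Proof. by rewrite -!Order.le_val !valM; apply: osg_le_mull. Qed.

Fact ssg_le_mulr (x a b : ssg_sort H) : a <= b -> a * x <= b * x.
Proof. by rewrite -!Order.le_val !valM; apply: osg_le_mulr. Qed.

HB.instance Definition _ := isOrderedSemigroup.Build d (ssg_sort H)
  ssg_sort_nonempty ssg_le_mull ssg_le_mulr.
End SubsemigroupStructure.

Definition ssg_osg (d : Order.disp_t) (S : orderedSemigroupType d)
  (H : subsemigroup S) : orderedSemigroupType d := ssg_sort H.

Section OrderedSemigroupNotions.
Context {d : Order.disp_t} {S : orderedSemigroupType d}.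
Implicit Types (a b : S) (A B : set S).

(* [pow a n] is a^n for n > 0; a semigroup has no unit, and [pow a 0] is the
   junk value [a]. *)
Definition pow a (n : nat) : S := iterop n *%g a a.

Definition prodset A B : set S := [set x * y | x in A & y in B].

(* The down-closure (A] is [down A], from classical_sets. *)
Definition left_ideal A : Prop :=
  [/\ A !=set0, prodset setT A `<=` A & down A = A].

Definition right_ideal A : Prop :=
  [/\ A !=set0, prodset A setT `<=` A & down A = A].

Definition ideal A : Prop := left_ideal A /\ right_ideal A.

Definition Lideal a : set S := down ([set a] `|` prodset setT [set a]).

Definition Lrel a b : Prop := Lideal a = Lideal b.

Definition Reg : set S :=
  [set a | down (prodset (prodset [set a] setT) [set a]) a].

Definition least_reg_exp a (m : nat) : Prop :=
  [/\ (0 < m)%N, Reg (pow a m) &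
      forall k : nat, (0 < k)%N -> Reg (pow a k) -> (m <= k)%N].

(* When S is pi-regular the least exponents exist (and are unique), so this is
   the relation a^m L b^n for these exponents. *)
Definition Lstar a b : Prop :=
  exists m n : nat,
    [/\ least_reg_exp a m, least_reg_exp b n & Lrel (pow a m) (pow b n)].

Definition nil_extension (K : set S) : Prop :=
  ideal K /\ forall a, exists2 m : nat, (0 < m)%N & K (pow a m).

Definition semilattice_congruence (rho : S -> S -> Prop) : Prop :=
  [/\ RelationClasses.Equivalence rho,
      forall a b x, rho a b -> rho (x * a) (x * b) /\ rho (a * x) (b * x),
      forall a, rho a (pow a 2) &
      forall a b, rho (a * b) (b * a)].

End OrderedSemigroupNotions.

Definition left_simple (d : Order.disp_t) (S : orderedSemigroupType d) : Prop :=
  forall A : set S, left_ideal A -> A = setT.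

Definition pi_regular (d : Order.disp_t) (S : orderedSemigroupType d) : Prop :=
  forall a : S, exists2 m : nat, (0 < m)%N &
    down (prodset (prodset [set pow a m] setT) [set pow a m]) (pow a m).

Definition right_weakly_commutative (d : Order.disp_t)
    (S : orderedSemigroupType d) : Prop :=
  forall a b : S, exists2 n : nat, (0 < n)%N &
    down (prodset setT [set a]) (pow (a * b) n).

Definition left_pi_t_simple (d : Order.disp_t)
    (S : orderedSemigroupType d) : Prop :=
  exists H : subsemigroup S,
    [/\ left_simple (ssg_osg H), pi_regular (ssg_osg H) &
        forall a : S, exists2 m : nat, (0 < m)%N & ssg_set H (pow a m)].

Definition nil_extension_of_left_simple_pi_regular (d : Order.disp_t)
    (S : orderedSemigroupType d) : Prop :=
  exists K : subsemigroup S,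
    [/\ nil_extension K, left_simple (ssg_osg K) & pi_regular (ssg_osg K)].

Definition semilattice_of (d : Order.disp_t)
    (tau : orderedSemigroupType d -> Prop) (S : orderedSemigroupType d) : Prop :=
  exists2 rho : S -> S -> Prop, semilattice_congruence rho &
    forall a : S, exists2 T : subsemigroup S,
      (T : set S) = [set x | rho a x] & tau (ssg_osg T).

(* Main.v *)
Require Import Defs.
From mathcomp Require Import all_boot all_order.
From mathcomp Require Import boolp classical_sets.

Local Open Scope order_scope.
Local Open Scope classical_set_scope.
Local Open Scope group_scope.

(** The proof rests on the relation "[a] right-divides a power of [c]", i.e.
    [c^n] lies in (Sa] for some [n].  Under right weak commutativity it is a
    preorder and the divisors of [c] in this sense form a filter: [ab] divides a
    power of [c] iff both [a] and [b] do.  The equivalence of this preorder is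
    therefore a semilattice congruence, and it is compatible with the order of
    [S], so that a factorisation [u <= v w] of an element of a class [T] with
    [v] divisible by [u] stays inside [T].  In each class, the intersection of
    the left ideals (Tt] is the required left simple ideal: it contains every
    regular element of [T]. *)

(** * Powers, and elementwise forms of left simplicity and pi-regularity *)

Section Powers.
Context {d : Order.disp_t} {S : orderedSemigroupType d}.
Implicit Types a b c s t u v x : S.

Lemma le_mul {a b c e : S} : a <= b -> c <= e -> a * c <= b * e.
Proof.
move=> ab ce; apply: Order.le_trans (osg_le_mulr c a b ab) _.
exact: osg_le_mull.
Qed.

(** Both exponents are successors because [pow a 0] is [a], for which the law fails. *)
Lemma powD a m n : pow a (m.+1 + n.+1) = pow a m.+1 * pow a n.+1.
Proof.
elim: m => [//|m IHm].
by rewrite addSn -[LHS]/(a * pow a (m.+1 + n.+1)) IHm mulgA.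
Qed.

Lemma powSr a n : pow a n.+2 = pow a n.+1 * a.
Proof. by rewrite -addn1 powD. Qed.

Lemma powM a m n : pow (pow a m.+1) n.+1 = pow a (m.+1 * n.+1).
Proof.
elim: n => [|n IHn]; first by rewrite muln1.
by rewrite powSr IHn (mulnS m.+1 n.+1) addnC -powD.
Qed.

Lemma pow_mul_rot a b n : pow (a * b) n.+2 = a * pow (b * a) n.+1 * b.
Proof.
elim: n => [|n IHn]; first by rewrite /pow /= !mulgA.
rewrite -[LHS]/(a * b * pow (a * b) n.+2) IHn.
by rewrite -[pow (b * a) n.+2]/(b * a * pow (b * a) n.+1) !mulgA.
Qed.

Lemma pow_le a b n : a <= b -> pow a n.+1 <= pow b n.+1.
Proof. by move=> ab; elim: n => [//|n IHn]; apply: le_mul. Qed.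

(** The bound [u <= u * x * u] can be substituted for the leading [u] again and again. *)
Lemma le_mul_pow u x n : u <= u * x * u -> u <= u * pow (x * u) n.+1.
Proof.
move=> ux; elim: n => [|n IHn]; first by rewrite mulgA.
apply: Order.le_trans IHn _; rewrite -[pow _ n.+2]/(x * u * pow (x * u) n.+1).
by rewrite (mulgA u (x * u)) (mulgA u x); apply: osg_le_mulr.
Qed.

Lemma down_mulTP a x : down (prodset setT [set a]) x <-> exists s, x <= s * a.
Proof.
split=> [[_ [[s _ [_ -> <-]] xs]]|[s xs]]; first by exists s.
by exists (s * a); split=> //; exists s => //; exists a.
Qed.

Lemma down_mulTmulP a b x :
  down (prodset (prodset [set a] setT) [set b]) x <->
  exists s, x <= a * s * b.
Proof.
split=> [[_ [[_ [_ -> [s _ <-]] [_ -> <-]] xs]]|[s xs]]; first by exists s.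
exists (a * s * b); split=> //; exists (a * s); last by exists b.
by exists a => //; exists s.
Qed.

(** (Sa] is itself a left ideal, and every left ideal containing [a] contains it. *)
Lemma left_simpleP : left_simple S <-> forall a b, exists s, b <= s * a.
Proof.
split=> [Ssimple a b|Sdiv A [[a Aa] AS dA]].
  have -> // : (exists s, b <= s * a) = (setT : set S) b.
  rewrite -(Ssimple [set x | exists s, x <= s * a]) //; split.
  - by exists (a * a); exists a.
  - move=> _ [t _ [x [s xs] <-]]; exists (t * s).
    by rewrite -mulgA; apply: osg_le_mull.
  - apply/seteqP; split=> [x [y [[s ys] xy]]|x xa].
      by exists s; apply: Order.le_trans ys.
    by exists x.
apply/seteqP; split=> // b _; have [s bs] := Sdiv a b.
by rewrite -dA; exists (s * a); split=> //; apply: AS; exists s => //; exists a.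
Qed.

Lemma pi_regularP :
  pi_regular S <->
  forall a, exists n s, pow a n.+1 <= pow a n.+1 * s * pow a n.+1.
Proof.
split=> [Sreg a|Sreg a].
  by have [[//|n] _ /down_mulTmulP[s ns]] := Sreg a; exists n, s.
by have [n [s ns]] := Sreg a; exists n.+1 => //; apply/down_mulTmulP; exists s.
Qed.

End Powers.

(** * Passing between a subsemigroup and the ambient semigroup *)

Section Subsemigroups.
Context {d : Order.disp_t} {S : orderedSemigroupType d}.
Variable H : subsemigroup S.

Definition ssg_val (x : ssg_osg H) : S := \val (x : ssg_sort H).

Lemma ssg_valP x : ssg_set H (ssg_val x).
Proof. exact: set_mem (valP (x : ssg_sort H)). Qed.

Lemma ssg_val_le x y : (x <= y) = (ssg_val x <= ssg_val y).
Proof. by []. Qed.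

Lemma ssg_valM x y : ssg_val (x * y) = ssg_val x * ssg_val y.
Proof. by []. Qed.

Lemma ssg_val_pow x n : ssg_val (pow x n.+1) = pow (ssg_val x) n.+1.
Proof.
by elim: n => [//|n IHn]; rewrite -[pow x n.+2]/(x * pow x n.+1) ssg_valM IHn.
Qed.

Lemma ssg_val_surj a : ssg_set H a -> exists x : ssg_osg H, ssg_val x = a.
Proof. by move=> /mem_set Ha; exists (exist _ a Ha). Qed.

Lemma left_simple_ssgP :
  left_simple (ssg_osg H) <->
  forall a b, ssg_set H a -> ssg_set H b -> exists2 h, ssg_set H h & b <= h * a.
Proof.
rewrite left_simpleP; split=> Hdiv.
  move=> _ _ /ssg_val_surj[a <-] /ssg_val_surj[b <-].
  have [s] := Hdiv a b; rewrite ssg_val_le ssg_valM => bs.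
  by exists (ssg_val s) => //; apply: ssg_valP.
move=> a b.
have [_ /ssg_val_surj[s <-] bs] := Hdiv _ _ (ssg_valP a) (ssg_valP b).
by exists s.
Qed.

Lemma pi_regular_ssgP :
  pi_regular (ssg_osg H) <->
  forall a, ssg_set H a ->
  exists n s, ssg_set H s /\ pow a n.+1 <= pow a n.+1 * s * pow a n.+1.
Proof.
rewrite pi_regularP; split=> Hreg.
  move=> _ /ssg_val_surj[a <-]; have [n [s]] := Hreg a.
  rewrite ssg_val_le !ssg_valM ssg_val_pow => ns.
  by exists n, (ssg_val s); split=> //; apply: ssg_valP.
move=> a; have [n [_ [/ssg_val_surj[s <-] ns]]] := Hreg _ (ssg_valP a).
by exists n, s; rewrite ssg_val_le !ssg_valM ssg_val_pow.
Qed.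

End Subsemigroups.
Arguments ssg_val {d S H}.

(** * Divisibility of powers and its semilattice congruence *)

Section PowerDivisibility.
Context {d : Order.disp_t} {S : orderedSemigroupType d}.
Implicit Types a b c s t u v w x : S.

Definition divpow a c := exists n s, pow c n.+1 <= s * a.

Lemma divpow_refl a : divpow a a.
Proof. by exists 1%N, a. Qed.

Lemma divpow_mull s a : divpow a (s * a).
Proof. by exists 0%N, s. Qed.

Lemma divpow_le a b : a <= b -> divpow b a.
Proof. by move=> ab; exists 1%N, a; apply: le_mul. Qed.

Lemma divpow_mulIl s a c : divpow (s * a) c -> divpow a c.
Proof. by move=> [n [t nt]]; exists n, (t * s); rewrite -mulgA. Qed.

Lemma divpow_powI a n c : divpow (pow a n.+1) c -> divpow a c.
Proof. by case: n => [//|n]; rewrite powSr; apply: divpow_mulIl. Qed.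

Lemma right_weakly_commutativeP :
  right_weakly_commutative S <-> forall a b, divpow a (a * b).
Proof.
split=> rwc a b.
  by have [[//|n] _ /down_mulTP[s ns]] := rwc a b; exists n, s.
by have [n [s ns]] := rwc a b; exists n.+1 => //; apply/down_mulTP; exists s.
Qed.

Lemma divpow_mulr a b : right_weakly_commutative S -> divpow a (a * b).
Proof. by move=> /right_weakly_commutativeP. Qed.

(** If c^(m+1) <= ta and c^(n+1) <= sb, a power of c lies below a power of tasb. By cyclic rotation
    that power is tas(btas)^(k+1)b, and right weak commutativity bounds (btas)^(k+1) by a left
    multiple of bta, so the whole bound ends in ab. *)
Lemma divpowM a b c :
  right_weakly_commutative S -> divpow a c -> divpow b c -> divpow (a * b) c.
Proof.
move=> rwc [m [t mt]] [n [s ns]].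
have [k [r kr]] := divpow_mulr (b * t * a) s rwc.
exists ((m.+1 + n.+1) * k.+2).-1, (t * a * s * r * b * t).
have -> : (((m.+1 + n.+1) * k.+2).-1).+1 = ((m + n.+1).+1 * k.+2)%N by [].
rewrite -powM; apply: (@Order.le_trans _ _ (pow (t * a * s * b) k.+2)).
  by apply: pow_le; rewrite -addSn powD -(mulgA (t * a)); apply: le_mul.
have -> : t * a * s * r * b * t * (a * b) = t * a * s * (r * (b * t * a)) * b.
  by rewrite !mulgA.
rewrite pow_mul_rot; apply: osg_le_mulr; apply: osg_le_mull.
by rewrite !mulgA in kr *.
Qed.

Lemma divpow_pow a n c :
  right_weakly_commutative S -> divpow a c -> divpow (pow a n.+1) c.
Proof. by move=> rwc ac; elim: n => [//|n IHn]; apply: divpowM. Qed.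

(** Some power of [b] lies below a left multiple of [a], and by [divpow_pow] that very power still
    divides a power of [c]. *)
Lemma divpow_trans b a c :
  right_weakly_commutative S -> divpow a b -> divpow b c -> divpow a c.
Proof.
move=> rwc [n [s ns]] /(divpow_pow _ n _ rwc)[k [t kt]].
exists k, (t * s); apply: Order.le_trans kt _.
by rewrite -mulgA; apply: osg_le_mull.
Qed.

Lemma divpowME a b c :
  right_weakly_commutative S -> divpow (a * b) c <-> divpow a c /\ divpow b c.
Proof.
move=> rwc; split=> [abc|[ac bc]]; last exact: divpowM.
split; last exact: divpow_mulIl abc.
exact: divpow_trans (divpow_mulr a b rwc) abc.
Qed.

Lemma divpow_powE a n c :
  right_weakly_commutative S -> divpow (pow a n.+1) c <-> divpow a c.
Proof. by move=> rwc; split; [apply: divpow_powI|apply: divpow_pow]. Qed.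

(** Comparing all [c], rather than asking for mutual divisibility, makes this an equivalence
    outright and lets [divpowME] act by rewriting. *)
Definition divpow_equiv a b := forall c, divpow a c <-> divpow b c.

Lemma divpow_equivP a b :
  right_weakly_commutative S ->
  divpow_equiv a b <-> divpow a b /\ divpow b a.
Proof.
move=> rwc; split=> [ab|[ab ba] c].
  by split; apply/ab; apply: divpow_refl.
by split; apply: divpow_trans.
Qed.

(** By [divpowME] a product behaves as a conjunction, so the semilattice laws are those of logical
    conjunction. *)
Lemma divpow_equiv_semilattice_congruence :
  right_weakly_commutative S -> semilattice_congruence divpow_equiv.
Proof.
move=> rwc; split.
- split=> [a c|a b ab c|b a c ab bc e]; first by [].
    by rewrite ab.
  by rewrite ab.
- by move=> a b x ab; split=> c; rewrite !divpowME // ab.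
- by move=> a c; rewrite divpow_powE.
- by move=> a b c; rewrite !divpowME // and_comm.
Qed.

Lemma divpow_equivM a b c :
  right_weakly_commutative S ->
  divpow_equiv a b -> divpow_equiv a c -> divpow_equiv a (b * c).
Proof.
by move=> rwc ab ac x; rewrite divpowME // -ab -ac; split=> [|[]].
Qed.

Lemma divpow_equiv_pow a b n :
  right_weakly_commutative S ->
  divpow_equiv a b -> divpow_equiv a (pow b n.+1).
Proof. by move=> rwc ab x; rewrite divpow_powE. Qed.

Lemma divpow_equiv_le_mul u v w :
  right_weakly_commutative S -> u <= v * w -> divpow u v -> divpow_equiv u v.
Proof.
move=> rwc uvw uv; apply/divpow_equivP => //; split=> //.
by have /divpowME[] := divpow_le _ _ uvw.
Qed.

(** Regularity lets [u] absorb any power of [x * u] on its right, so a bound on a power becomes a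
    bound on [u] itself. *)
Lemma divpow_regular u x t :
  u <= u * x * u -> divpow t (x * u) ->
  exists r, u <= u * r * t.
Proof.
move=> ux [n [r nr]]; exists r; apply: Order.le_trans (le_mul_pow _ _ n ux) _.
by rewrite -mulgA; apply: osg_le_mull.
Qed.

End PowerDivisibility.

(** * The left simple kernel of a class *)

Section Kernel.
Context {d : Order.disp_t} {S : orderedSemigroupType d}.
Implicit Types a b k s t u x : S.

Definition class_kernel a : set S :=
  [set k | divpow_equiv a k /\
     forall t, divpow_equiv a t -> exists2 s, divpow_equiv a s & k <= s * t].

(** Every [t] of the class divides a power of [x * u], because [u] does; hence [u <= u * r * t]. As
    [u] divides a power of [u * r], this cofactor stays in the class. *)
Lemma class_kernel_regular a u x :
  right_weakly_commutative S -> divpow_equiv a u -> u <= u * x * u ->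
  class_kernel a u.
Proof.
move=> rwc au ux; split=> // t at_.
have [|r ur] := divpow_regular u x t ux.
  by apply/at_/au; apply: divpow_mull.
exists (u * r) => // c; rewrite au.
exact: divpow_equiv_le_mul rwc ur (divpow_mulr u r rwc) c.
Qed.

Lemma class_kernel_mull a s k :
  right_weakly_commutative S -> divpow_equiv a s -> class_kernel a k ->
  class_kernel a (s * k).
Proof.
move=> rwc as_ [ak kT]; split=> [|t at_]; first exact: divpow_equivM.
have [r ar kr] := kT t at_; exists (s * r); first exact: divpow_equivM.
by rewrite -mulgA; apply: osg_le_mull.
Qed.

Lemma class_kernel_le a k x :
  divpow_equiv a x -> class_kernel a k -> x <= k -> class_kernel a x.
Proof.
move=> ax [_ kT] xk; split=> // t /kT[s as_ ks].
by exists s => //; apply: Order.le_trans ks.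
Qed.

(* Exponents at least 2 are available because [x^2] also has a regular power. *)
Lemma class_kernel_pow a x :
  pi_regular S -> right_weakly_commutative S -> divpow_equiv a x ->
  exists n, class_kernel a (pow x n.+2).
Proof.
move=> /pi_regularP Sreg rwc ax; have [n [s]] := Sreg (pow x 2).
rewrite powM mul2n doubleS => ns; exists n.*2.
by apply: class_kernel_regular ns => //; apply: divpow_equiv_pow.
Qed.

(** From k <= s x^(n+1) follows kx <= s x^(n+2). Here x^(n+2) is in the kernel, which absorbs left
    factors from the class. *)
Lemma class_kernel_mulr a k x :
  pi_regular S -> right_weakly_commutative S -> class_kernel a k ->
  divpow_equiv a x -> class_kernel a (k * x).
Proof.
move=> Sreg rwc [ak kT] ax; have [n Kx] := class_kernel_pow a x Sreg rwc ax.
have [s as_ ks] := kT _ (divpow_equiv_pow _ _ n rwc ax).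
apply: (@class_kernel_le a (s * pow x n.+2)); first exact: divpow_equivM.
  exact: class_kernel_mull.
by rewrite powSr mulgA; apply: osg_le_mulr.
Qed.

Lemma class_kernel_left_simple a b k :
  right_weakly_commutative S -> class_kernel a b -> class_kernel a k ->
  exists2 h, class_kernel a h & k <= h * b.
Proof.
move=> rwc Kb [ak kT]; have [ab _] := Kb.
(* Dividing by [b * b] instead of [b] leaves one [b] to put the cofactor [s * b] into the kernel. *)
have [s as_ ks] := kT _ (divpow_equivM _ _ _ rwc ab ab).
by exists (s * b); [apply: class_kernel_mull|rewrite -mulgA].
Qed.

(* If [u <= u s u] then [s u s] is again a weak inverse of [u], and it is itself
   regular, hence in the kernel. *)
Lemma class_kernel_pi_regular a k :
  pi_regular S -> right_weakly_commutative S -> class_kernel a k ->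
  exists n h,
    class_kernel a h /\ pow k n.+1 <= pow k n.+1 * h * pow k n.+1.
Proof.
move=> /pi_regularP Sreg rwc [ak _]; have [n [s us]] := Sreg k.
have {ak} au := divpow_equiv_pow _ _ n rwc ak.
exists n, (s * pow k n.+1 * s); set u := pow k n.+1 in us au *.
have us2 : u <= u * s * u * s * u.
  by apply: Order.le_trans (us) _; do 2!apply: osg_le_mulr.
split; last by rewrite !mulgA.
have su : divpow s u by have /divpowME[//|/divpowME[]] := divpow_le _ _ us.
apply: (@class_kernel_regular _ _ u) => // [c|].
  rewrite au; suff: divpow_equiv u (s * u * s) by [].
  apply/divpow_equivP => //; split; last first.
    by rewrite !divpowME //; have := divpow_refl u.
  have : divpow (s * u) (s * u * s) by apply: divpow_mulr.
  by apply: divpow_mulIl.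
have := osg_le_mulr s _ _ (osg_le_mull s _ _ us2).
by rewrite !mulgA.
Qed.

Lemma divpow_class_closed a :
  right_weakly_commutative S ->
  forall x y, [set z | divpow_equiv a z] x -> [set z | divpow_equiv a z] y ->
  [set z | divpow_equiv a z] (x * y).
Proof. by move=> rwc x y /= ax ay; apply: divpow_equivM. Qed.

Definition divpow_class (rwc : right_weakly_commutative S) a : subsemigroup S :=
  @Subsemigroup _ _ [set x | divpow_equiv a x]
    (ex_intro _ a (fun=> iff_refl _)) (divpow_class_closed a rwc).

Lemma divpow_class_nil_extension (rwc : right_weakly_commutative S) a :
  pi_regular S ->
  nil_extension_of_left_simple_pi_regular (ssg_osg (divpow_class rwc a)).
Proof.
move=> Sreg; set T := divpow_class rwc a.
have inT (x : ssg_osg T) : divpow_equiv a (ssg_val x) := ssg_valP T x.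
(* The kernel lives in [S]; [A] views it inside the class, and [liftA] brings factors found in [S]
   back there. *)
pose A : set (ssg_osg T) := [set x | class_kernel a (ssg_val x)].
have liftA k : class_kernel a k -> exists2 x, A x & ssg_val x = k.
  move=> Kk; have [x xk] := ssg_val_surj T k Kk.1.
  by exists x => //; rewrite /A /= xk.
have powA (x : ssg_osg T) : exists2 m, (0 < m)%N & A (pow x m).
  have [n Kx] := class_kernel_pow a _ Sreg rwc (inT x).
  by exists n.+2 => //; rewrite -ssg_val_pow in Kx.
have A0 : A !=set0.
  have [x _] := osg_nonempty (s := ssg_osg T).
  by have [m _ Am] := powA x; exists (pow x m).
have AM (x y : ssg_osg T) : A x -> A y -> A (x * y).
  by move=> _ Ay; apply: class_kernel_mull a _ _ rwc (inT x) Ay.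
have dA : down A = A.
  apply/seteqP; split=> [x [y [Ay xy]]|x Ax]; last by exists x.
  exact: class_kernel_le a _ _ (inT x) Ay xy.
exists (@Subsemigroup _ _ A A0 AM); split.
- split=> //; split; split=> //.
    by move=> _ [x _ [y Ay <-]]; apply: class_kernel_mull a _ _ rwc (inT x) Ay.
  move=> _ [x Ax [y _ <-]].
  exact: class_kernel_mulr a _ _ Sreg rwc Ax (inT y).
- apply/left_simple_ssgP => b k Ab Ak.
  have [_ /liftA[h Ah <-] kh] := class_kernel_left_simple a _ _ rwc Ab Ak.
  by exists h.
- apply/pi_regular_ssgP => k Ak.
  have [n [_ [/liftA[h Ah <-] kh]]] := class_kernel_pi_regular a _ Sreg rwc Ak.
  by exists n, h; split=> //; rewrite ssg_val_le !ssg_valM ssg_val_pow.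
Qed.

End Kernel.

(** * The implications between the five conditions *)

Section Implications.
Context {d : Order.disp_t} {S : orderedSemigroupType d}.
Implicit Types a b u v x : S.

Lemma semilattice_of_mono (tau tau' : orderedSemigroupType d -> Prop) :
  (forall T, tau T -> tau' T) -> semilattice_of tau S -> semilattice_of tau' S.
Proof.
move=> tau_tau' [rho rho_cong rhoT]; exists rho => // a.
by have [T Ta tauT] := rhoT a; exists T => //; apply: tau_tau'.
Qed.

(** Two related elements have powers in the left simple subsemigroup of their class, where each
    power lies below a left multiple of the other. Regularity of a power is inherited from that
    subsemigroup. *)
Lemma semilattice_left_pi_t_simple_divpow :
  semilattice_of (@left_pi_t_simple d) S ->
  pi_regular S /\
  exists2 rho : S -> S -> Prop, semilattice_congruence rho &
    forall a b, rho a b -> divpow b a.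
Proof.
move=> [rho rho_cong rhoT]; have [[rho_refl _ _] _ _ _] := rho_cong; split.
  apply/pi_regularP => a.
  have [T Ta [H [_ /pi_regular_ssgP Hreg Hnil]]] := rhoT a.
  have [x xa] : exists x : ssg_osg T, ssg_val x = a.
    by apply: ssg_val_surj; rewrite Ta; apply: rho_refl.
  have [[//|m] _ /Hreg[n [s [_]]]] := Hnil x.
  rewrite ssg_val_le !ssg_valM !ssg_val_pow xa powM => ns.
  by exists (m.+1 * n.+1).-1, (ssg_val s).
exists rho => // a b ab.
have [T Ta [H [/left_simple_ssgP Hsimple _ Hnil]]] := rhoT a.
have [x xa] : exists x : ssg_osg T, ssg_val x = a.
  by apply: ssg_val_surj; rewrite Ta; apply: rho_refl.
have [y yb] : exists y : ssg_osg T, ssg_val y = b.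
  by apply: ssg_val_surj; rewrite Ta.
have [[//|m] _ Hx] := Hnil x; have [[//|n] _ Hy] := Hnil y.
have [h _] := Hsimple _ _ Hy Hx.
rewrite ssg_val_le ssg_valM !ssg_val_pow xa yb => mn.
by apply: (@divpow_powI _ _ _ n); exists m, (ssg_val h).
Qed.

Lemma least_reg_exp_exists a : pi_regular S -> exists n, least_reg_exp a n.+1.
Proof.
move=> Sreg; pose P n := (0 < n)%N && `[< Reg (pow a n) >].
have exP : exists n, P n.
  by have [n n0 an] := Sreg a; exists n; rewrite /P n0; apply/asboolP.
case: (ex_minnP exP) => [[//|n] /andP[_ /asboolP an] nmin].
exists n; split=> // k k0 ak; apply: nmin; rewrite /P k0; exact/asboolP.
Qed.

Lemma Lideal_sub a b s : a <= s * b -> Lideal a `<=` Lideal b.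
Proof.
move=> ab x [_ [[->|[t _ [_ -> <-]]] xa]].
  exists (s * b); split; last exact: Order.le_trans ab.
  by right; exists s => //; exists b.
exists (t * (s * b)); split; last first.
  exact: Order.le_trans xa (osg_le_mull _ _ _ ab).
by right; exists (t * s) => //; exists b => //; rewrite mulgA.
Qed.

(** All powers of [a * b] and [b * a] lie in one class, and regular elements of one class generate
    the same left ideal, whatever the two least exponents are. *)
Lemma semilattice_left_pi_t_simple_Lstar :
  semilattice_of (@left_pi_t_simple d) S ->
  pi_regular S /\ (forall a b : S, Lstar (a * b) (b * a)).
Proof.
move=> /semilattice_left_pi_t_simple_divpow[Sreg [rho]].
move=> [[rho_refl rho_sym rho_trans] rhoM rho_sq rhoC] rho_div; split=> // a b.
have rho_pow x n : rho x (pow x n.+1).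
  elim: n => [|n IHn]; first exact: rho_refl.
  exact: rho_trans (rho_sq x) (rhoM _ _ x IHn).1.
(* [x u] and [x u v] lie in the same class even though that class may be
   strictly below the one of [u]. *)
have Lsub u v : rho u v -> Reg u -> Lideal u `<=` Lideal v.
  move=> uv /down_mulTmulP[x ux].
  have [|r] := divpow_regular u x (x * u * v) ux.
    apply: rho_div; rewrite -mulgA; apply: (rhoM _ _ x _).1.
    exact: rho_trans (rho_sq u) (rhoM _ _ u uv).1.
  by rewrite mulgA; apply: Lideal_sub.
have [m mP] := least_reg_exp_exists (a * b) Sreg.
have [n nP] := least_reg_exp_exists (b * a) Sreg.
exists m.+1, n.+1; split=> //.
have [_ ab_reg _] := mP; have [_ ba_reg _] := nP.
have ab_ba : rho (pow (a * b) m.+1) (pow (b * a) n.+1).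
  exact: rho_trans (rho_trans _ _ _ (rho_sym _ _ (rho_pow _ m)) (rhoC a b))
                   (rho_pow _ n).
by apply/seteqP; split; apply: Lsub => //; apply: rho_sym.
Qed.

Lemma Lstar_right_weakly_commutative :
  (forall a b : S, Lstar (a * b) (b * a)) -> right_weakly_commutative S.
Proof.
move=> SL; apply/right_weakly_commutativeP => a b.
have [m [n [[m_gt0 _ _] [n_gt0 _ _]]]] := SL a b.
case: m n m_gt0 n_gt0 => [|m] [|n] // _ _ mn.
apply: (divpow_mulIl b); apply: (@divpow_powI _ _ _ n).
have : Lideal (pow (a * b) m.+1) (pow (a * b) m.+1).
  by exists (pow (a * b) m.+1); split=> //; left.
rewrite mn => -[_ [[->|[s _ [_ -> <-]]] ms]]; last by exists m, s.
(* Here (ab)^(m+1) <= (ba)^(n+1) without a left factor; multiplying by (ab)^(m+1) supplies one and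
   raises the exponent to 2m+2. *)
exists m.*2.+1, (pow (a * b) m.+1).
by rewrite -addnn -addnS -addSn powD; apply: osg_le_mull.
Qed.

(** Let u = (ab)^(n+1) with u <= usu. Both a and b divide a power of su, hence so does (ba)^(n+2),
    and [divpow_regular] turns this into a bound on u. *)
Lemma right_weakly_commutative_pow :
  pi_regular S -> right_weakly_commutative S ->
  forall a b : S, exists2 m : nat, (0 < m)%N &
    down (prodset (prodset [set pow (a * b) m] setT) [set pow (b * a) m.+1])
         (pow (a * b) m).
Proof.
move=> /pi_regularP Sreg rwc a b; have [n [s us]] := Sreg (a * b).
exists n.+1 => //; apply/down_mulTmulP.
apply: (divpow_regular _ s) => //; apply/divpow_powE => //.
have /divpowME[//|_] := divpow_refl (s * pow (a * b) n.+1).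
by rewrite divpow_powE // !divpowME //; case.
Qed.

Lemma pow_mul_regular_right_weakly_commutative :
  (forall a b : S, exists2 m : nat, (0 < m)%N &
    down (prodset (prodset [set pow (a * b) m] setT) [set pow (b * a) m.+1])
         (pow (a * b) m)) ->
  pi_regular S /\ right_weakly_commutative S.
Proof.
move=> Spow; split.
  apply/pi_regularP => a; have [[//|m] _ /down_mulTmulP[s]] := Spow a a.
  rewrite -[a * a]/(pow a 2) !powM => ms.
  (* With b = a the right factor is a^(2m+4), which exceeds a^(2m+2) by one a^2; the surplus goes
     into the middle factor. *)
  exists (2 * m.+1).-1, (s * pow a 2); rewrite prednK //.
  apply: Order.le_trans ms _; rewrite -!mulgA; do 2!apply: osg_le_mull.
  by rewrite (mulnS 2 m.+1) mul2n doubleS powD (mulgA a).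
apply/right_weakly_commutativeP => a b.
have [[//|m] _ /down_mulTmulP[s ms]] := Spow a b.
apply: (divpow_mulIl b); apply: (@divpow_powI _ _ _ m.+1).
by exists m, (pow (a * b) m.+1 * s).
Qed.

End Implications.

Theorem theorem2p5 (d : Order.disp_t) (S : orderedSemigroupType d) :
  [<-> semilattice_of (@left_pi_t_simple d) S ;
       pi_regular S /\ (forall a b : S, Lstar (a * b) (b * a)) ;
       pi_regular S /\ right_weakly_commutative S ;
       forall a b : S, exists2 m : nat, (0 < m)%N &
         down (prodset (prodset [set pow (a * b) m] setT)
                       [set pow (b * a) m.+1])
              (pow (a * b) m) ;
       semilattice_of (@nil_extension_of_left_simple_pi_regular d) S ].
Proof.
tfae.
- exact: semilattice_left_pi_t_simple_Lstar.
- by move=> [Sreg /Lstar_right_weakly_commutative].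
- by move=> [Sreg rwc]; apply: right_weakly_commutative_pow.
- move=> /pow_mul_regular_right_weakly_commutative[Sreg rwc].
  exists divpow_equiv; first exact: divpow_equiv_semilattice_congruence.
  move=> a; exists (divpow_class rwc a) => //.
  exact: divpow_class_nil_extension.
- apply: semilattice_of_mono => T [K [[_ Knil] Ksimple Kreg]].
  by exists K.
Qed.
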